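(* Let $X=c_0(\mathbb{Z})$ or $X=\ell_p(\mathbb{Z})$ with $1\le p<\infty$ (over $\mathbb{K}\in\{\mathbb{R},\mathbb{C}\}$), and let $F_w$, $w\in\mathbb{K}^{\mathbb{Z}}$, be an invertible bilateral weighted forward shift on $X$. Then the following are equivalent: (i) $F_w$ is uniformly topologically expansive; (ii) there is a decomposition $I_+\cup I_-=\mathbb{Z}$ such that $$|w_{i+n-1}\cdots w_i|=\|F_w^n(e_i)\|\to\infty\quad\text{uniformly on } I_+\text{ as } n\to\infty,$$ $$|w_{i-n}\cdots w_{i-1}|^{-1}=\|F_w^{-n}(e_i)\|\to\infty\quad\text{uniformly on } I_-\text{ as } n\to\infty.$$
   Context: The bilateral weighted forward shift is $F_w((x_n)_{n\in\mathbb{Z}})=(w_{n-1}x_{n-1})_{n\in\mathbb{Z}}$, so $F_we_i=w_ie_{i+1}$, where $e_i=(\delta_{i,j})_{j\in\mathbb{Z}}$. On these spaces $F_w$ is a (bounded) invertible operator iff $w$ is bounded and $\inf_i|w_i|>0$. An invertible bounded operator $T$ on a normed space $X$ is uniformly topologically expansive (with respect to the norm) if the unit sphere $S=\{x:\|x\|=1\}$ can be written as $S=A\cup B$ with $\|T^nx\|\to\infty$ uniformly on $A$ and $\|T^{-n}x\|\to\infty$ uniformly on $B$ as $n\to\infty$. Here $f_n\to\infty$ uniformly on $E$ means: for every $R>0$ there is $n_0$ with $f_n(x)\ge R$ for all $n\ge n_0$, $x\in E$ (vacuous if $E=\emptyset$). *)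

(* Defs.v *)
From HB Require Import structures.
From mathcomp Require Import all_boot all_order all_algebra.
From mathcomp Require Import finmap.
From mathcomp Require Import complex.
From mathcomp Require Import all_classical all_reals all_analysis.
From mathcomp Require Import ring lra.

Set Implicit Arguments.
Unset Strict Implicit.
Unset Printing Implicit Defensive.

Import Order.TTheory GRing.Theory Num.Theory.
Import numFieldNormedType.Exports.

Local Open Scope classical_set_scope.
Local Open Scope ring_scope.

Section Operators.
Variables (K : numFieldType) (V : normedModType K).

(* [M : K] positive forces [M] to be real when [K] is the field of complex
   numbers, and the norm of [V] takes its values in the nonnegative reals
   of [K]. *)
Definition diverges_uniformly (T : Type) (f : nat -> T -> K) (E : set T) : Prop :=
  forall M : K, 0 < M ->
    exists n0 : nat, forall n x, (n0 <= n)%N -> E x -> M <= f n x.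

Definition bounded_operator (f : V -> V) : Prop :=
  exists M : K, forall x, `|f x| <= M * `|x|.

Record invertible_operator : Type := InvertibleOperator {
  fwd_op :> {linear V -> V};
  inv_op : V -> V;
  fwd_opK : cancel fwd_op inv_op;
  inv_opK : cancel inv_op fwd_op;
  fwd_op_bounded : bounded_operator fwd_op;
  inv_op_bounded : bounded_operator inv_op }.

Definition uniformly_topologically_expansive (T : invertible_operator) : Prop :=
  exists A B : set V,
    [/\ [set x : V | `|x| = 1] = A `|` B,
        diverges_uniformly (fun n x => `|iter n T x|) A &
        diverges_uniformly (fun n x => `|iter n (inv_op T) x|) B].

End Operators.

Inductive scalars : Type := RealScalars | ComplexScalars.

Definition scalar_field (R : realType) (s : scalars) : numFieldType :=
  match s with
  | RealScalars => R
  | ComplexScalars => R[i]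
  end.

Section ScalarField.
Variables (R : realType) (s : scalars).
Local Notation K := (scalar_field R s).

(* The library norm of [R[i]] has values in [R[i]]; [modulus] is the same
   absolute value with values in [R], see [normE]. *)
Definition of_real : R -> K :=
  match s return R -> scalar_field R s with
  | RealScalars => fun r => r
  | ComplexScalars => fun r => r%:C%C
  end.

Definition modulus : K -> R :=
  match s return scalar_field R s -> R with
  | RealScalars => fun x => `|x|
  | ComplexScalars => fun z => ComplexField.Normc.normc z
  end.

End ScalarField.

Lemma normE (R : realType) s (x : scalar_field R s) :
  `|x| = of_real s (modulus x).
Proof. by case: s x. Qed.

Section ScalarFieldTheory.
Variables (R : realType) (s : scalars).
Local Notation K := (scalar_field R s).
Implicit Types x y : K.

Lemma of_realD (a b : R) : of_real s (a + b) = of_real s a + of_real s b.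
Proof. by case: s => //=; rewrite rmorphD. Qed.

Lemma of_realM (a b : R) : of_real s (a * b) = of_real s a * of_real s b.
Proof. by case: s => //=; rewrite rmorphM. Qed.

Lemma of_real0 : of_real s (0 : R) = 0.
Proof. by case: s. Qed.

Lemma of_real1 : of_real s (1 : R) = 1.
Proof. by case: s. Qed.

Lemma ler_of_real (a b : R) : (of_real s a <= of_real s b) = (a <= b).
Proof. by case: s => //=; rewrite lecR. Qed.

Lemma of_real_inj : injective (@of_real R s).
Proof. by move=> a b /eqP; rewrite eq_le !ler_of_real -eq_le => /eqP. Qed.

Lemma modulus_ge0 x : 0 <= modulus x.
Proof. by rewrite -(ler_of_real 0) of_real0 -normE. Qed.

Lemma modulusD x y : modulus (x + y) <= modulus x + modulus y.
Proof. by rewrite -ler_of_real of_realD -!normE ler_normD. Qed.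

Lemma modulusM x y : modulus (x * y) = modulus x * modulus y.
Proof. by apply: of_real_inj; rewrite of_realM -!normE normrM. Qed.

Lemma modulus0 : modulus (0 : K) = 0.
Proof. by apply: of_real_inj; rewrite of_real0 -normE normr0. Qed.

Lemma modulus0_eq0 x : modulus x = 0 -> x = 0.
Proof. by move=> h; apply/normr0_eq0; rewrite normE h of_real0. Qed.

End ScalarFieldTheory.

Section EsumBounds.
Variable R : realType.
Implicit Types f g : int -> R.

Lemma esum_le_fset f (c : R) : (forall i, 0 <= f i) ->
  (\esum_(i in [set: int]) (f i)%:E <= c%:E)%E <->
  (forall A : {fset int}, \sum_(i <- A) f i <= c).
Proof.
move=> f0; split=> [h A|h].
  rewrite -lee_fin (le_trans _ h)// -sumEFin; apply: ereal_sup_ubound.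
  exists [set` A]; first by split.
  by rewrite fsbig_finite//= set_fsetK.
apply: ge_ereal_sup => _ [A [finA _] <-].
by rewrite fsbig_finite//= sumEFin lee_fin.
Qed.

Lemma esum_fin f (c : R) : (forall i, 0 <= f i) ->
  (forall A : {fset int}, \sum_(i <- A) f i <= c) ->
  (\esum_(i in [set: int]) (f i)%:E < +oo)%E.
Proof. by move=> f0 /(esum_le_fset _ f0) /le_lt_trans; apply; rewrite ltry. Qed.

End EsumBounds.

Inductive sequence_space (R : realType) : Type :=
| C0
| Lp (p : R) of 1 <= p.
Arguments C0 {R}.

Section SequenceSpaces.
Variables (R : realType) (s : scalars).
Local Notation K := (scalar_field R s).
Implicit Types (X : sequence_space R) (x y : int -> K) (p : R).

(* [x i] tends to [0] as [`|i|] tends to infinity. *)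
Definition null_sequence x : Prop :=
  x n%:Z @[n --> \oo] --> (0 : K) /\ x (- n%:Z) @[n --> \oo] --> (0 : K).

Definition psum p x : \bar R := \esum_(i in [set: int]) (modulus (x i) `^ p)%:E.

Definition in_space X : pred (int -> K) := fun x =>
  match X with
  | C0 => `[< null_sequence x >]
  | Lp p _ => (psum p x < +oo)%E
  end.

Definition space_norm X x : R :=
  match X with
  | C0 => sup (range (fun i => modulus (x i)))
  | Lp p _ => fine (psum p x) `^ p^-1
  end.

Lemma modulus_pow_ge0 p x i : 0 <= modulus (x i) `^ p.
Proof. exact: powR_ge0. Qed.

Lemma psum_ge0 p x : (0 <= psum p x)%E.
Proof. by apply: esum_ge0 => i _; rewrite lee_fin powR_ge0. Qed.

Lemma psum_fineK p x : (psum p x < +oo)%E -> (fine (psum p x))%:E = psum p x.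
Proof. by move=> h; rewrite fineK// ge0_fin_numE// psum_ge0. Qed.

Lemma psum_lep p x : (psum p x < +oo)%E ->
  forall A : {fset int}, \sum_(i <- A) modulus (x i) `^ p <= fine (psum p x).
Proof.
move=> h; apply/esum_le_fset; first exact: modulus_pow_ge0.
by rewrite psum_fineK.
Qed.

Lemma lp_norm_pow p x : 1 <= p -> (fine (psum p x) `^ p^-1) `^ p = fine (psum p x).
Proof.
move=> p1; have p0 : 0 < p by rewrite (lt_le_trans _ p1).
by rewrite -powRrM mulVf ?gt_eqF// powRr1// fine_ge0// psum_ge0.
Qed.

Lemma modulus_le_lp p x i : 1 <= p -> (psum p x < +oo)%E ->
  modulus (x i) <= fine (psum p x) `^ p^-1.
Proof.
move=> p1 h; have p0 : 0 < p by rewrite (lt_le_trans _ p1).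
have := psum_lep h [fset i]%fset; rewrite big_seq_fset1 => hi.
rewrite -[leLHS](@powRr1 R) ?modulus_ge0//.
rewrite -(divff (lt0r_neq0 p0)) powRrM ge0_ler_powR ?nnegrE ?powR_ge0//.
- by rewrite invr_ge0 ltW.
- by rewrite fine_ge0// psum_ge0.
Qed.

Lemma lp_norm0 p x : 1 <= p -> (psum p x < +oo)%E ->
  fine (psum p x) `^ p^-1 = 0 -> x = 0.
Proof.
move=> p1 h n0; apply/funext => i; apply: modulus0_eq0.
by apply/eqP; rewrite eq_le modulus_ge0 andbT -n0 modulus_le_lp.
Qed.

Lemma psum0 p : 1 <= p -> psum p 0 = 0%E.
Proof.
move=> p1; rewrite /psum esum1// => i _.
by rewrite modulus0 powR0// gt_eqF// (lt_le_trans _ p1).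
Qed.

Lemma psumZ_le p x (a : K) : 1 <= p -> (psum p x < +oo)%E ->
  (psum p (a *: x)%R <= (modulus a `^ p * fine (psum p x))%:E)%E.
Proof.
move=> p1 h; apply/esum_le_fset => [|A]; first exact: modulus_pow_ge0.
apply: (@le_trans _ _ (\sum_(i <- A) modulus a `^ p * modulus (x i) `^ p)).
  by apply: ler_sum => i _; rewrite modulusM powRM// modulus_ge0.
by rewrite -mulr_sumr ler_wpM2l ?powR_ge0// psum_lep.
Qed.

Lemma lp_normZ_le p x (a : K) : 1 <= p -> (psum p x < +oo)%E ->
  fine (psum p (a *: x)) `^ p^-1 <= modulus a * fine (psum p x) `^ p^-1.
Proof.
move=> p1 h; have p0 : 0 < p by rewrite (lt_le_trans _ p1).
have hz := psumZ_le a p1 h.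
have hz' : (psum p (a *: x)%R < +oo)%E by rewrite (le_lt_trans hz)// ltry.
have -> : modulus a = (modulus a `^ p) `^ p^-1.
  by rewrite -powRrM divff ?gt_eqF// powRr1// modulus_ge0.
have f0 : 0 <= fine (psum p x) by rewrite fine_ge0// psum_ge0.
rewrite -powRM ?powR_ge0// ge0_ler_powR ?nnegrE ?mulr_ge0 ?powR_ge0//.
- by rewrite invr_ge0 ltW.
- by rewrite fine_ge0// psum_ge0.
- by rewrite -lee_fin psum_fineK.
Qed.

Lemma psumD_le_pos p x y (a b : R) : 1 <= p -> 0 < a -> 0 < b ->
  (forall A : {fset int}, \sum_(i <- A) modulus (x i) `^ p <= a `^ p) ->
  (forall A : {fset int}, \sum_(i <- A) modulus (y i) `^ p <= b `^ p) ->
  (psum p (x + y)%R <= ((a + b) `^ p)%:E)%E.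
Proof.
move=> p1 ap bp hx hy; have p0 : 0 < p by rewrite (lt_le_trans _ p1).
have an : a != 0 by rewrite gt_eqF.
have bn : b != 0 by rewrite gt_eqF.
have abp : 0 < a + b by exact: addr_gt0.
have abn : a + b != 0 by rewrite gt_eqF.
have t0 : 0 <= a / (a + b) by apply: divr_ge0; exact: ltW.
have t1 : a / (a + b) <= 1 by rewrite ler_pdivrMr// mul1r lerDl ltW.
pose t := Itv01 t0 t1.
have key i : modulus ((x + y) i) `^ p <=
    (a + b) `^ p * (a / (a + b) / a `^ p * modulus (x i) `^ p +
                    b / (a + b) / b `^ p * modulus (y i) `^ p).
  have h : modulus ((x + y) i) <=
      (a + b) * (a / (a + b) * (modulus (x i) / a) +
                 (1 - a / (a + b)) * (modulus (y i) / b)).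
    rewrite (_ : _ * _ = modulus (x i) + modulus (y i)) ?modulusD//.
    by field; rewrite ?an ?bn ?abn.
  apply: le_trans (ge0_ler_powR (ltW p0) _ _ h) _.
  - by rewrite nnegrE modulus_ge0.
  - by rewrite nnegrE (le_trans _ h)// modulus_ge0.
  have t1' : 0 <= 1 - a / (a + b) by rewrite subr_ge0.
  have xa0 : 0 <= modulus (x i) / a.
    by apply: divr_ge0; [exact: modulus_ge0 | exact: ltW].
  have yb0 : 0 <= modulus (y i) / b.
    by apply: divr_ge0; [exact: modulus_ge0 | exact: ltW].
  rewrite powRM ?(ltW abp)//; last by apply: addr_ge0; exact: mulr_ge0.
  rewrite ler_wpM2l ?powR_ge0//.
  have := @convex_powR R p p1 t (modulus (x i) / a) (modulus (y i) / b).
  rewrite !convRE /= => cv; apply: le_trans (cv _ _) _.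
  - by rewrite inE/= in_itv/= andbT.
  - by rewrite inE/= in_itv/= andbT.
  have dv (u v : R) : 0 <= u -> 0 < v -> (u / v) `^ p = u `^ p / v `^ p.
    move=> u0 v0; rewrite powRM ?invr_ge0 ?(ltW v0)//.
    by rewrite -powR_inv1 ?(ltW v0)// -powRrM mulN1r powRN.
  rewrite !dv ?modulus_ge0// /unstable.onem.
  rewrite (_ : 1 - a / (a + b) = b / (a + b)); last by field.
  by rewrite !mulrA [X in X + _ <= _]mulrAC [X in _ + X <= _]mulrAC.
apply/esum_le_fset => [|A]; first exact: modulus_pow_ge0.
apply: le_trans (ler_sum _ (fun i _ => key i)) _.
rewrite -mulr_sumr big_split/= -!mulr_sumr ler_piMr ?powR_ge0//.
have ha := hx A; have hb := hy A.
have -> : 1 = a / (a + b) + b / (a + b) :> R by rewrite -mulrDl divff.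
apply: lerD; rewrite -mulrA; apply: ler_piMr => //.
- by rewrite mulrC ler_pdivrMr ?powR_gt0// mul1r.
- by apply: divr_ge0; exact: ltW.
- by rewrite mulrC ler_pdivrMr ?powR_gt0// mul1r.
Qed.

Lemma psumD_le p x y : 1 <= p -> (psum p x < +oo)%E -> (psum p y < +oo)%E ->
  (psum p (x + y)%R <=
     ((fine (psum p x) `^ p^-1 + fine (psum p y) `^ p^-1) `^ p)%:E)%E.
Proof.
move=> p1 hx hy.
have [ae|an] := eqVneq (fine (psum p x) `^ p^-1) 0.
  by rewrite (lp_norm0 p1 hx ae) add0r psum0// fine0 powR0 ?add0r
    ?lp_norm_pow ?psum_fineK// invr_neq0// gt_eqF// (lt_le_trans _ p1).
have [be|bn] := eqVneq (fine (psum p y) `^ p^-1) 0.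
  by rewrite (lp_norm0 p1 hy be) addr0 psum0// fine0 powR0 ?addr0
    ?lp_norm_pow ?psum_fineK// invr_neq0// gt_eqF// (lt_le_trans _ p1).
apply: psumD_le_pos => // [| |A|A].
- by rewrite lt0r an powR_ge0.
- by rewrite lt0r bn powR_ge0.
- by rewrite lp_norm_pow// psum_lep.
- by rewrite lp_norm_pow// psum_lep.
Qed.

Lemma lp_normD p x y : 1 <= p -> (psum p x < +oo)%E -> (psum p y < +oo)%E ->
  fine (psum p (x + y)) `^ p^-1 <=
    fine (psum p x) `^ p^-1 + fine (psum p y) `^ p^-1.
Proof.
move=> p1 hx hy; have p0 : 0 < p by rewrite (lt_le_trans _ p1).
have h := psumD_le p1 hx hy.
have hxy : (psum p (x + y)%R < +oo)%E by rewrite (le_lt_trans h)// ltry.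
rewrite -[leRHS](@powRr1 R) ?addr_ge0 ?powR_ge0//.
rewrite -(divff (lt0r_neq0 p0)) [leRHS]powRrM.
rewrite ge0_ler_powR ?nnegrE ?powR_ge0//.
- by rewrite invr_ge0 ltW.
- by rewrite fine_ge0// psum_ge0.
- by rewrite -lee_fin psum_fineK.
Qed.

Lemma null_sequence_bounded x : null_sequence x ->
  exists M : R, forall i, modulus (x i) <= M.
Proof.
have nat_case (u : nat -> K) : u n @[n --> \oo] --> (0 : K) ->
    exists M : R, forall n, modulus (u n) <= M.
  move=> /cvgrPdist_le /(_ 1 ltr01) [N _ hN].
  exists (1 + \sum_(k < N) modulus (u k)) => n.
  have S0 (P : pred 'I_N) : 0 <= \sum_(k < N | P k) modulus (u k).
    by apply: sumr_ge0 => k _; exact: modulus_ge0.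
  have [nN|Nn] := ltnP n N.
    rewrite (bigD1 (Ordinal nN))//= addrCA lerDl addr_ge0//.
  have := hN n Nn; rewrite /= sub0r normrN normE -(of_real1 R s) ler_of_real.
  by move=> /le_trans; apply; rewrite lerDl.
move=> [/nat_case [M1 h1] /nat_case [M2 h2]].
exists (Num.max M1 M2) => -[n|n]; first by rewrite le_max h1.
by rewrite NegzE le_max h2 orbT.
Qed.

Lemma modulus_le_sup x i : null_sequence x ->
  modulus (x i) <= sup (range (fun i => modulus (x i))).
Proof.
move=> /null_sequence_bounded [M hM]; apply: ub_le_sup; last by exists i.
by exists M => _ [j _ <-].
Qed.

Lemma sup_modulus_le x (M : R) : (forall i, modulus (x i) <= M) ->
  sup (range (fun i => modulus (x i))) <= M.
Proof.
move=> hM; apply: ge_sup; first by exists (modulus (x 0)), 0.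
by move=> _ [j _ <-].
Qed.

Lemma in_space_submod X : submod_closed (in_space X).
Proof.
split=> [|a x y].
  rewrite unfold_in /in_space; case: X => [|p p1]; last by rewrite psum0 ?ltry.
  by apply/asboolP; split; exact: cvg_cst.
rewrite !unfold_in /in_space; case: X => [|p p1].
  have lim0 (u v : nat -> K) : u n @[n --> \oo] --> (0 : K) ->
      v n @[n --> \oo] --> (0 : K) -> a * u n + v n @[n --> \oo] --> (0 : K).
    move=> hu hv; have := cvgD (cvgM (cvg_cst a) hu) hv.
    by rewrite mulr0 addr0; apply.
  move=> /asboolP[x1 x2] /asboolP[y1 y2]; apply/asboolP.
  by split; exact: lim0.
move=> hx hy; have hax : (psum p (a *: x)%R < +oo)%E.
  by apply: le_lt_trans (psumZ_le a p1 hx) _; rewrite ltry.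
by apply: le_lt_trans (psumD_le p1 hax hy) _; rewrite ltry.
Qed.

Lemma space_normD X x y : in_space X x -> in_space X y ->
  space_norm X (x + y) <= space_norm X x + space_norm X y.
Proof.
case: X => [|p p1] /=; last exact: lp_normD.
move=> /asboolP hx /asboolP hy; apply: sup_modulus_le => i.
by apply: le_trans (modulusD _ _) _; apply: lerD; apply: modulus_le_sup.
Qed.

Lemma space_normZ_le X (a : K) x : in_space X x ->
  space_norm X (a *: x) <= modulus a * space_norm X x.
Proof.
case: X => [|p p1] /=; last exact: lp_normZ_le.
move=> /asboolP hx; apply: sup_modulus_le => i.
by rewrite modulusM ler_wpM2l ?modulus_ge0//; apply: modulus_le_sup.
Qed.

Lemma space_norm0_eq0 X x : in_space X x -> space_norm X x = 0 -> x = 0.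
Proof.
case: X => [|p p1] /=; last exact: lp_norm0.
move=> /asboolP hx h0; apply/funext => i; apply: modulus0_eq0.
by apply/eqP; rewrite eq_le modulus_ge0 andbT -h0; exact: modulus_le_sup.
Qed.

Lemma space_norm_ge0 X x : in_space X x -> 0 <= space_norm X x.
Proof.
case: X => [|p p1] /=; last by move=> _; exact: powR_ge0.
by move=> /asboolP hx; apply: le_trans (modulus_le_sup 0 hx); exact: modulus_ge0.
Qed.

End SequenceSpaces.

Section SpaceType.
Variables (R : realType) (s : scalars) (X : sequence_space R).
Local Notation K := (scalar_field R s).

HB.instance Definition _ :=
  GRing.isSubmodClosed.Build K (int -> K) (@in_space R s X)
    (@in_space_submod R s X).

(* The underlying type of [X] is the set of sequences satisfying [in_space X],
   with the pointwise operations and the norm [space_norm X]. *)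
Record seq_space : Type := SeqSpace {
  coord :> int -> K;
  coordP : coord \in @in_space R s X }.

HB.instance Definition _ := [isSub for coord].
HB.instance Definition _ := [Choice of seq_space by <:].
HB.instance Definition _ := [SubChoice_isSubLmodule of seq_space by <:].

Definition norm_of (x : seq_space) : K := of_real s (space_norm X x).

Lemma norm_ofD (x y : seq_space) : norm_of (x + y) <= norm_of x + norm_of y.
Proof.
rewrite /norm_of -of_realD ler_of_real.
exact: (space_normD (coordP x) (coordP y)).
Qed.

Lemma norm_ofZ (a : K) (x : seq_space) : norm_of (a *: x) = `|a| * norm_of x.
Proof.
rewrite normE /norm_of -of_realM; congr of_real.
have [->|an] := eqVneq a 0.
  rewrite scale0r modulus0 mul0r; apply/eqP; rewrite eq_le.
  rewrite (space_norm_ge0 (coordP (0 : seq_space))) andbT.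
  have := space_normZ_le 0 (coordP (0 : seq_space)).
  by rewrite modulus0 mul0r scale0r.
apply/eqP; rewrite eq_le (space_normZ_le _ (coordP x))/=.
have := space_normZ_le a^-1 (coordP (a *: x)).
rewrite [_ *: _](_ : _ = coord x); last first.
  by rewrite /= scalerA mulVf// scale1r.
have ma : 0 < modulus a.
  rewrite lt0r modulus_ge0 andbT.
  by apply: contra an => /eqP /modulus0_eq0 ->.
have -> : modulus a^-1 = (modulus a)^-1.
  apply: (mulfI (lt0r_neq0 ma)); rewrite -modulusM divff// divff ?lt0r_neq0//.
  by apply: (@of_real_inj _ s); rewrite -normE normr1 of_real1.
by rewrite mulrC ler_pdivlMr// mulrC.
Qed.

Lemma norm_of_eq0 (x : seq_space) : norm_of x = 0 -> x = 0.
Proof.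
rewrite /norm_of -(of_real0 R s) => /of_real_inj h.
by apply/val_inj; exact: (space_norm0_eq0 (coordP x) h).
Qed.

HB.instance Definition _ :=
  Lmodule_isNormed.Build K seq_space norm_ofD norm_ofZ norm_of_eq0.

Lemma space_normE (x : seq_space) : `|x| = of_real s (space_norm X x).
Proof. by []. Qed.

Definition unit_sequence (i : int) : int -> K := fun j => (i == j)%:R.

Lemma unit_sequence_in (i : int) : unit_sequence i \in @in_space R s X.
Proof.
rewrite unfold_in /in_space; case: X => [|p p1].
  apply/asboolP; split; apply: cvg_near_cst; exists `|i|.+1%N => // n /= hn;
    rewrite /unit_sequence; case: eqP => // ie; move: hn; rewrite ie.
  - by rewrite absz_nat ltnn.
  - by rewrite abszN absz_nat ltnn.
apply: (@esum_fin _ _ 1) => [j|A]; first exact: powR_ge0.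
have p0 : p != 0 by rewrite gt_eqF// (lt_le_trans _ p1).
have m1 : modulus (1 : K) = 1.
  by apply: (@of_real_inj _ s); rewrite -normE normr1 of_real1.
have hj j : modulus (unit_sequence i j) `^ p = (i == j)%:R :> R.
  rewrite /unit_sequence; case: eqP => _ /=.
    by rewrite m1 powR1.
  by rewrite modulus0 powR0.
rewrite (eq_bigr _ (fun j _ => hj j)).
have [iA|iA] := boolP (i \in A).
  rewrite (big_fsetD1 i)//= eqxx big_seq big1 ?addr0// => j.
  by rewrite !inE => /andP[/negbTE ji _]; rewrite eq_sym ji.
rewrite big_seq big1 ?ler01// => j jA.
by case: eqP => // ij; move: iA; rewrite ij jA.
Qed.

Definition unit_vector (i : int) : seq_space := SeqSpace (unit_sequence_in i).

End SpaceType.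

Definition forward_shift (K : numFieldType) (w x : int -> K) : int -> K :=
  fun n => w (n - 1) * x (n - 1).

(* Main.v *)
(* F^n and F^-n move the i-th coordinate to a fixed distance and multiply it by
   the n-th weight product at i, so testing on the unit vectors gives (i) -> (ii).
   Conversely, the norm is monotone in the moduli of the coordinates, so F^n
   expands the part of x supported in Iplus, hence x itself, by at least the
   smallest weight product on Iplus, and likewise F^-n on Iminus; one of the two
   parts of a unit vector has norm at least 1/2. *)
Require Import Defs.
From mathcomp Require Import all_boot all_order all_algebra.
From mathcomp Require Import all_classical all_reals all_analysis.
From mathcomp Require Import zify.
Import Order.TTheory GRing.Theory Num.Theory.
Import numFieldNormedType.Exports.

Local Open Scope classical_set_scope.
Local Open Scope ring_scope.

(** * Norm comparison by coordinates, and weighted translations *)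

Section SequenceSpace.
Context {R : realType} {s : scalars} {X : sequence_space R}.
Local Notation K := (scalar_field R s).
Local Notation V := (seq_space s X).

Lemma ler_modulus (a b : K) : (`|a| <= `|b|) = (modulus a <= modulus b).
Proof. by rewrite !normE ler_of_real. Qed.

(** Solidity of $X$: this keeps the restriction of a vector to an arbitrary set of indices inside
    $X$. *)
Lemma in_space_dominated (x y : int -> K) :
  (forall i, `|x i| <= `|y i|) -> in_space X y -> in_space X x.
Proof.
move=> xy; case: X => [|p p1] /=.
  have lim0 (u v : nat -> K) : (forall n, `|u n| <= `|v n|) ->
      v n @[n --> \oo] --> (0 : K) -> u n @[n --> \oo] --> (0 : K).
    move=> uv /cvgrPdist_le v0; apply/cvgrPdist_le => e /v0.
    apply: filterS => n; rewrite !sub0r !normrN; exact: le_trans.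
  move=> /asboolP[y1 y2]; apply/asboolP.
  by split; [move: y1|move: y2]; apply: lim0 => n; exact: xy.
apply: le_lt_trans; apply: le_esum => i _; rewrite lee_fin.
apply: ge0_ler_powR; rewrite ?nnegrE ?modulus_ge0// -?ler_modulus//.
exact: le_trans p1.
Qed.

(** The supremum and the $p$-sum do not change when the index is translated. The offset [d] allows a
    vector to be compared directly with its image under an iterate of the shift. *)
Lemma norm_le_translate (x y : V) (d : int) :
  (forall i, `|x i| <= `|y (i + d)|) -> `|x| <= `|y|.
Proof.
move=> xy; rewrite !space_normE ler_of_real.
have := coordP y; have := coordP x; rewrite !unfold_in.
case: X x y xy => [|p p1] x y xy /=.
  move=> _ /asboolP y0; apply: sup_modulus_le => i.
  by apply: le_trans (modulus_le_sup (i + d) y0); rewrite -ler_modulus.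
move=> x0 y0; have p0 : 0 <= p by rewrite (le_trans _ p1).
apply: ge0_ler_powR; rewrite ?nnegrE ?invr_ge0 ?fine_ge0 ?psum_ge0//.
rewrite -lee_fin !psum_fineK// /psum.
rewrite [leRHS](reindex_esum [set: int] [set: int] (+%R^~ d)); last first.
  by rewrite setTT_bijective; exists (+%R^~ (- d)) => i; rewrite /= (addrK, subrK).
apply: le_esum => i _; rewrite lee_fin.
by apply: ge0_ler_powR; rewrite ?nnegrE ?modulus_ge0// -ler_modulus.
Qed.

Lemma norm_unit_vector (i : int) : `|unit_vector s X i| = 1.
Proof.
have m1 : modulus (1 : K) = 1.
  by apply: (@of_real_inj _ s); rewrite -normE normr1 of_real1.
have mE j : modulus (unit_sequence R s i j) = (i == j)%:R.
  by rewrite /unit_sequence; case: eqP; rewrite (m1, modulus0).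
rewrite space_normE -(of_real1 R s); congr of_real.
have := unit_sequence_in s X i; rewrite unfold_in.
rewrite /unit_vector /=; case: X => [|p p1] /=.
  move=> /asboolP e0; apply/eqP; rewrite eq_le; apply/andP; split.
    by apply: sup_modulus_le => j; rewrite mE lern1 leq_b1.
  by apply: le_trans (modulus_le_sup i e0); rewrite mE eqxx.
move=> _; have p0 : p != 0 by rewrite gt_eqF// (lt_le_trans _ p1).
rewrite /psum (esumID [set i]) => [|j _]; last by rewrite lee_fin powR_ge0.
rewrite !setTI esum_set1; last by rewrite lee_fin powR_ge0.
rewrite mE eqxx powR1 esum1 ?adde0 /= ?powR1// => j /eqP ji.
by rewrite mE eq_sym (negbTE ji) powR0.
Qed.

Lemma restrict_in (E : set int) (x : V) : patch (fun=> 0) E x \in @in_space R s X.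
Proof.
rewrite unfold_in; apply: (@in_space_dominated _ x); last exact: coordP.
by move=> i; rewrite /patch; case: ifP; rewrite ?normr0.
Qed.

Definition restrict (E : set int) (x : V) : V := SeqSpace (restrict_in E x).

(** [E] and [E'] may overlap, so [x] is split along [E] and its complement. The complement lies in
    [E'], so the triangle inequality rules out both norms being below $1/2$. *)
Lemma norm_restrict_half (E E' : set int) (x : V) : E `|` E' = [set: int] ->
  `|x| = 1 -> (2^-1 <= `|restrict E x|) || (2^-1 <= `|restrict E' x|).
Proof.
move=> EE' x1; pose E'' := ~` E.
have xE : x = restrict E x + restrict E'' x.
  apply/val_inj/funext => i /=.
  rewrite [RHS]/(_ + _) /= /patch in_setC.
  by case: (i \in E) => /=; symmetry; [exact: addr0|exact: add0r].
have E''E' : `|restrict E'' x| <= `|restrict E' x|.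
  apply: (@norm_le_translate _ _ 0) => i; rewrite addr0 /= /patch.
  case: ifPn => [|_]; last by rewrite normr0.
  rewrite in_setC notin_setE => nEi.
  have : [set: int] i by [].
  by rewrite -EE' => -[//|/mem_set ->].
(* The order on [K] is only partial in the complex case; negating an inequality needs both sides
   real. *)
have half_real : (2^-1 : K) \is Num.real by rewrite realV realn.
have ltNge (z : V) : ~~ (2^-1 <= `|z|) -> `|z| < 2^-1.
  by rewrite -(real_ltNge (normr_real z) half_real).
apply: contraT; rewrite negb_or => /andP[/ltNge lt1 /ltNge lt2].
suff : (1 : K) < 1 by rewrite ltxx.
rewrite -{1}x1 xE (le_lt_trans (ler_normD _ _))//.
rewrite (le_lt_trans (lerD (lexx _) E''E'))// [ltRHS]splitr !mul1r.
exact: ltrD lt1 lt2.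
Qed.

(* A common form for the iterates of a weighted shift and of its inverse. *)
Definition weighted_translation (G : V -> V) (d : int) (c : int -> K) : Prop :=
  forall x i, G x (i + d) = c i * x i.

(** The image of $e_i$ is $c_i e_{i+d}$. *)
Lemma norm_weighted_translation_unit {G d c} (i : int) :
  weighted_translation G d c -> `|G (unit_vector s X i)| = `|c i|.
Proof.
move=> Gdc; rewrite -[RHS]mulr1 -(norm_unit_vector (i + d)) -normrZ.
congr `|_|; apply/val_inj/funext => j /=.
transitivity (c i * unit_sequence R s (i + d) j); last by [].
rewrite -[j](subrK d) Gdc /= /unit_sequence (inj_eq (addIr d)).
by case: eqP => [->|_]; rewrite ?mulr0.
Qed.

Lemma diverges_uniformly_restrict (G : nat -> V -> V) (d : nat -> int)
    (c : nat -> int -> K) (E : set int) :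
  (forall n, weighted_translation (G n) (d n) (c n)) ->
  diverges_uniformly (fun n i => `|c n i|) E ->
  diverges_uniformly (fun n x => `|G n x|)
    [set x | `|x| = 1 /\ 2^-1 <= `|restrict E x|].
Proof.
(* The factor 2 makes up for the bound $1/2$ on the norm of the restriction. *)
move=> Gdc cE M M0; have M20 : 0 < M * 2 by rewrite mulr_gt0.
have [n0 hn0] := cE _ M20.
exists n0 => n x n0n [_ xE].
(* Coordinate [i] on the left is compared with coordinate [i + d n] on the right; outside [E] the
   left one vanishes. *)
have : `|(M * 2) *: restrict E x| <= `|G n x|.
  apply: (@norm_le_translate _ _ (d n)) => i.
  rewrite Gdc; change (`|M * 2 * restrict E x i| <= `|c n i * x i|).
  rewrite (normrM (M * 2)) (normrM (c n i)) (gtr0_norm M20) /= /patch.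
  case: ifPn => [/set_mem Ei|_]; last by rewrite normr0 mulr0 mulr_ge0.
  by rewrite ler_wpM2r// hn0.
apply: le_trans; rewrite normrZ (gtr0_norm M20) -mulrA.
by rewrite ler_peMr ?(ltW M0)// -ler_pdivrMl// mulr1.
Qed.

(** Stated for two unrelated families [G] and [H]: the argument uses only their coordinate formulas,
    not that they are mutually inverse. *)
Lemma uniformly_expansive_translations (G H : nat -> V -> V)
    (d d' : nat -> int) (c c' : nat -> int -> K) :
  (forall n, weighted_translation (G n) (d n) (c n)) ->
  (forall n, weighted_translation (H n) (d' n) (c' n)) ->
  (exists A B : set V,
    [/\ [set x : V | `|x| = 1] = A `|` B,
        diverges_uniformly (fun n x => `|G n x|) A &
        diverges_uniformly (fun n x => `|H n x|) B]) <->
  exists I J : set int,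
    [/\ I `|` J = [set: int],
        diverges_uniformly (fun n i => `|c n i|) I &
        diverges_uniformly (fun n i => `|c' n i|) J].
Proof.
move=> Gdc Hdc; split=> [[A [B [AB GA HB]]]|[I [J [IJ cI cJ]]]].
  (* Each $e_i$ is on the unit sphere, hence in [A] or [B]; these preimages therefore cover
     $\mathbb{Z}$. *)
  exists (unit_vector s X @^-1` A), (unit_vector s X @^-1` B); split.
  - by rewrite -preimage_setU -AB; apply/seteqP; split => // i _; exact: norm_unit_vector.
  - move=> M /GA[n0 h]; exists n0 => n i n0n Ai.
    by rewrite -(norm_weighted_translation_unit i (Gdc n)) h.
  - move=> M /HB[n0 h]; exists n0 => n i n0n Bi.
    by rewrite -(norm_weighted_translation_unit i (Hdc n)) h.
exists [set x | `|x| = 1 /\ 2^-1 <= `|restrict I x|],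
       [set x | `|x| = 1 /\ 2^-1 <= `|restrict J x|]; split.
- apply/seteqP; split => x /=; last by case=> -[].
  move=> x1; have /orP[] := norm_restrict_half _ _ _ IJ x1; first by left.
  by right.
- exact: (diverges_uniformly_restrict _ _ _ _ Gdc cI).
- exact: (diverges_uniformly_restrict _ _ _ _ Hdc cJ).
Qed.

End SequenceSpace.

(** * Weight products of the shift and of its inverse *)

Section Shift.
Context {R : realType} {s : scalars} {X : sequence_space R}.
Local Notation K := (scalar_field R s).
Local Notation V := (seq_space s X).
Variables (w : int -> K) (F : invertible_operator V).
Hypothesis F_shift : forall x : V, (F x : int -> K) = forward_shift w x.

Lemma iter_forward_shift n :
  weighted_translation (iter n F) n%:Z (fun i => \prod_(k < n) w (i + k%:Z)).
Proof.
move=> x; elim: n => [|n IHn] i; first by rewrite big_ord0 mul1r addr0.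
rewrite iterS F_shift /forward_shift big_ord_recr /=.
rewrite (_ : i + n.+1%:Z - 1 = i + n%:Z); last by lia.
by rewrite IHn mulrCA mulrA.
Qed.

(** If $w_i=0$ then $F$ kills $e_i$, against injectivity. This permits division by weights in the
    formula for the inverse. *)
Lemma shift_weight_neq0 i : w i != 0.
Proof.
apply/eqP => wi0; have e0 : F (unit_vector s X i) = F 0.
  rewrite linear0; apply/val_inj/funext => j; rewrite /= F_shift /forward_shift.
  rewrite /= /unit_sequence.
  by case: eqP => [<-|_]; rewrite ?wi0 ?mul0r ?mulr0.
have := can_inj (fwd_opK F) e0 => /(congr1 Num.norm)/eqP.
by rewrite norm_unit_vector normr0 oner_eq0.
Qed.

Lemma iter_inv_shift n :
  weighted_translation (iter n (inv_op F)) (- n%:Z)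
    (fun i => (\prod_(k < n) w (i - k.+1%:Z))^-1).
Proof.
move=> x; elim: n => [|n IHn] i; first by rewrite big_ord0 invr1 mul1r subr0.
rewrite iterS big_ord_recr /= invfM -mulrA mulrCA -IHn.
set y := iter n _ _.
(* Reading $F(F^{-1}y)=y$ at $i-n$ gives $w_{i-n-1}(F^{-1}y)_{i-n-1}=y_{i-n}$, to be solved for the
   coordinate of $F^{-1}y$. *)
have := congr1 (fun z : V => z (i - n%:Z)) (inv_opK F y).
rewrite F_shift /forward_shift (_ : i - n%:Z - 1 = i - n.+1%:Z); last by lia.
by move=> <-; rewrite mulKf// shift_weight_neq0.
Qed.

End Shift.

Theorem corollary3p4 (R : realType) (s : scalars) (X : sequence_space R)
    (w : int -> scalar_field R s)
    (F : invertible_operator (seq_space s X))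
    (F_shift : forall x : seq_space s X,
       (F x : int -> scalar_field R s) = forward_shift w x) :
  [/\ (forall (n : nat) (i : int),
         `|\prod_(k < n) w (i + k%:Z)| = `|iter n F (unit_vector s X i)|),
      (forall (n : nat) (i : int),
         `|\prod_(k < n) w (i - k.+1%:Z)|^-1 = `|iter n (inv_op F) (unit_vector s X i)|) &
      uniformly_topologically_expansive F <->
      exists Iplus Iminus : set int,
        [/\ Iplus `|` Iminus = [set: int],
            diverges_uniformly
              (fun n i => `|\prod_(k < n) w (i + k%:Z)|) Iplus &
            diverges_uniformly
              (fun n i => `|\prod_(k < n) w (i - k.+1%:Z)|^-1) Iminus]].
Proof.
have Fn := iter_forward_shift w F F_shift.
have Vn := iter_inv_shift w F F_shift.
split=> [n i|n i|].
- by rewrite (norm_weighted_translation_unit i (Fn n)).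
- by rewrite (norm_weighted_translation_unit i (Vn n)) normfV.
(* The coefficients of $F^{-n}$ are inverse products, so the inverse has to move inside the norm. *)
- have normV : (fun n i => `|\prod_(k < n) w (i - k.+1%:Z)|^-1) =
      (fun n i => `|(\prod_(k < n) w (i - k.+1%:Z))^-1|).
    by apply/funext => n; apply/funext => i; rewrite normfV.
  by rewrite normV; exact: (uniformly_expansive_translations _ _ _ _ _ _ Fn Vn).
Qed.
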